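(* Consider a sequence (indexed by $N$) of completely randomized nearly uniform designs with $\min_{q\in[Q]}N_q\ge2$, with the constants $\underline c,\overline c$ fixed, satisfying Condition 3 with constant $\Delta$. Let $\hat V_{\hat\gamma}=F^\top\mathrm{diag}(N_q^{-1}\hat S(q,q))_{q\in[Q]}F$. Then (i) $\mathbb E\{\hat V_{\hat\gamma}\}\succeq V_{\hat\gamma}$; (ii) $\|\hat V_{\hat\gamma}-\mathbb E\{\hat V_{\hat\gamma}\}\|_\infty^2=O_{\mathbb P}\big(\|F\|_\infty^4Q^4N^{-3}\Delta^4H^2\big)$; (iii) $\|\hat V_{\hat\gamma}-\mathbb E\{\hat V_{\hat\gamma}\}\|_{\mathrm{op}}^2=O_{\mathbb P}\big(\|F\|_\infty^4Q^4N^{-3}\Delta^4H^4\big)$.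
   Context: Randomization model: there are $N$ units and $Q$ treatment levels with prescribed group sizes $N_1,\dots,N_Q\ge1$, $\sum_qN_q=N$; unit $i\in[N]$ has fixed real potential outcomes $Y_i(1),\dots,Y_i(Q)$. Under complete randomization the treatment vector $Z=(Z_1,\dots,Z_N)$ is uniform over all vectors in $[Q]^N$ with exactly $N_q$ coordinates equal to $q$; the observed outcome is $Y_i=Y_i(Z_i)$. Write $\overline Y(q)=N^{-1}\sum_iY_i(q)$, $S(q,q')=(N-1)^{-1}\sum_i(Y_i(q)-\overline Y(q))(Y_i(q')-\overline Y(q'))$, $S=(S(q,q'))$, $V_{\hat Y}=\mathrm{diag}(N_q^{-1}S(q,q))-N^{-1}S$, $\hat Y_q=N_q^{-1}\sum_{i:Z_i=q}Y_i$ and sample variance $\hat S(q,q)=(N_q-1)^{-1}\sum_{i:Z_i=q}(Y_i-\hat Y_q)^2$. For fixed $F\in\mathbb R^{Q\times H}$, $V_{\hat\gamma}=F^\top V_{\hat Y}F$. Norms: $\|A\|_\infty$ is the maximum absolute entry of a matrix, $\|A\|_{\mathrm{op}}$ the operator (spectral) norm. Nearly uniform design: there are a positive integer $N_0$ and constants $0<\underline c\le\overline c$ with $N_q=c_qN_0$, $\underline c\le c_q\le\overline c$ for all $q$. Condition 3: $\max_{q\in[Q]}N^{-1}\sum_{i=1}^N\{Y_i(q)-\overline Y(q)\}^4\le\Delta^4$. *)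

(* Defs.v *)
From HB Require Import structures.
From mathcomp Require Import all_boot all_order all_algebra.
From mathcomp Require Import boolp classical_sets reals.
Set Implicit Arguments. Unset Strict Implicit. Unset Printing Implicit Defensive.
Import Order.TTheory GRing.Theory Num.Theory.
Local Open Scope ring_scope.

Section Design.
Variable R : realType.

Definition assignment (N Q : nat) := {ffun 'I_N -> 'I_Q}.

Definition valid_assign (N Q : nat) (Nq : 'I_Q -> nat) : {set {ffun 'I_N -> 'I_Q}} :=
  [set z : {ffun 'I_N -> 'I_Q} | [forall q, #|[set i | z i == q]| == Nq q]].

Definition Prob (N Q : nat) (Nq : 'I_Q -> nat) (A : pred {ffun 'I_N -> 'I_Q}) : R :=
  #|[set z in valid_assign N Nq | A z]|%:R / #|valid_assign N Nq|%:R.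

Definition Expect (N Q : nat) (Nq : 'I_Q -> nat) (f : {ffun 'I_N -> 'I_Q} -> R) : R :=
  (\sum_(z in valid_assign N Nq) f z) / #|valid_assign N Nq|%:R.

Definition Ybar (N Q : nat) (Y : 'I_N -> 'I_Q -> R) (q : 'I_Q) : R :=
  N%:R^-1 * \sum_i Y i q.

Definition Smat (N Q : nat) (Y : 'I_N -> 'I_Q -> R) : 'M[R]_Q :=
  \matrix_(q, q') ((N%:R - 1)^-1 *
     \sum_i (Y i q - Ybar Y q) * (Y i q' - Ybar Y q')).

Definition VYhat (N Q : nat) (Nq : 'I_Q -> nat) (Y : 'I_N -> 'I_Q -> R) : 'M[R]_Q :=
  diag_mx (\row_q ((Nq q)%:R^-1 * Smat Y q q)) - N%:R^-1 *: Smat Y.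

Definition Vgamma (N Q H : nat) (Nq : 'I_Q -> nat) (Y : 'I_N -> 'I_Q -> R)
  (F : 'M[R]_(Q, H)) : 'M[R]_H := F^T *m VYhat Nq Y *m F.

Definition obs (N Q : nat) (Y : 'I_N -> 'I_Q -> R) (z : {ffun 'I_N -> 'I_Q}) (i : 'I_N) : R :=
  Y i (z i).

Definition Yhat (N Q : nat) (Nq : 'I_Q -> nat) (Y : 'I_N -> 'I_Q -> R)
  (z : {ffun 'I_N -> 'I_Q}) (q : 'I_Q) : R :=
  (Nq q)%:R^-1 * \sum_(i | z i == q) obs Y z i.

Definition Shat (N Q : nat) (Nq : 'I_Q -> nat) (Y : 'I_N -> 'I_Q -> R)
  (z : {ffun 'I_N -> 'I_Q}) (q : 'I_Q) : R :=
  ((Nq q)%:R - 1)^-1 * \sum_(i | z i == q) (obs Y z i - Yhat Nq Y z q) ^+ 2.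

Definition Vhat (N Q H : nat) (Nq : 'I_Q -> nat) (Y : 'I_N -> 'I_Q -> R)
  (F : 'M[R]_(Q, H)) (z : {ffun 'I_N -> 'I_Q}) : 'M[R]_H :=
  F^T *m diag_mx (\row_q ((Nq q)%:R^-1 * Shat Nq Y z q)) *m F.

Definition EVhat (N Q H : nat) (Nq : 'I_Q -> nat) (Y : 'I_N -> 'I_Q -> R)
  (F : 'M[R]_(Q, H)) : 'M[R]_H :=
  \matrix_(a, b) Expect Nq (fun z => Vhat Nq Y F z a b).

Definition psd (n : nat) (A : 'M[R]_n) : Prop :=
  forall x : 'cV[R]_n, 0 <= (x^T *m A *m x) 0 0.
Definition loewner_ge (n : nat) (A B : 'M[R]_n) : Prop := psd (A - B).

Definition maxnorm (m n : nat) (A : 'M[R]_(m, n)) : R :=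
  \big[Num.max/0]_(ij : 'I_m * 'I_n) `|A ij.1 ij.2|.

Definition vnorm (n : nat) (x : 'cV[R]_n) : R := Num.sqrt (\sum_i x i 0 ^+ 2).

Definition opnorm (m n : nat) (A : 'M[R]_(m, n)) : R :=
  sup [set vnorm (A *m x) | x in [set x : 'cV[R]_n | vnorm x = 1]]%classic.

Definition nearly_uniform (Q : nat) (cl ch : R) (Nq : 'I_Q -> nat) : Prop :=
  exists N0 : nat, (0 < N0)%N /\
    exists c : 'I_Q -> R, forall q, (Nq q)%:R = c q * N0%:R /\ cl <= c q /\ c q <= ch.

Definition condition3 (N Q : nat) (Y : 'I_N -> 'I_Q -> R) (Delta : R) : Prop :=
  forall q : 'I_Q, N%:R^-1 * \sum_i (Y i q - Ybar Y q) ^+ 4 <= Delta ^+ 4.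

Definition bigOP (Q N : nat -> nat) (Nq : forall k, 'I_(Q k) -> nat)
  (X : forall k, {ffun 'I_(N k) -> 'I_(Q k)} -> R) (r : nat -> R) : Prop :=
  forall eps : R, 0 < eps -> exists M : R, exists k0 : nat, forall k, (k0 <= k)%N ->
    Prob (Nq k) [pred z | M * r k < `|X k z|] <= eps.

End Design.

(* Main.v *)
Require Import Defs.
From HB Require Import structures.
From mathcomp Require Import boolp classical_sets reals.
From mathcomp Require Import all_boot all_order all_algebra all_fingroup.
From mathcomp Require Import ring lra.
Set Implicit Arguments. Unset Strict Implicit. Unset Printing Implicit Defensive.
Import Order.TTheory GRing.Theory Num.Theory.
Local Open Scope ring_scope.

(* (i) Exchangeability gives E Shat(q,q) = S(q,q), so E Vhat - V = N^-1 F^T S F, a Gram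
   matrix.

   (ii) Bounding the entries of Vhat - E Vhat group by group loses a factor Q, so the weak
   dependence between groups must be used. This is done with a Poincare inequality for
   random transpositions,
     N Var f(Z) <= sum_(i, j) E (f(Z o (i j)) - f(Z))^2,
   proved by induction on the set of positions being permuted: averaging first over the
   permutations that fix i splits the variance orthogonally, the between-part is controlled
   by the swaps (i l), and one averages over i. A swap changes only two of the
   Shat(q,q), each by O((y_i^2 + y_j^2 + average of y^2 over the group) / N_q), so the fourth
   moments suffice. The maximum norm is bounded by the sum of the squared entries, and
   Markov's inequality concludes.

   (iii) follows from |A|_op <= H |A|_oo. *)

(** * Sums of squares, Cauchy-Schwarz and centring *)

(** Lagrange's identity against the constant vector. It yields Cauchy-Schwarz, and it expresses a
    sample variance through pairwise differences. *)
Lemma sum_pair_sqrB (R : realFieldType) (I : finType) (P : pred I) (x : I -> R) :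
  \sum_(i | P i) \sum_(j | P j) (x i - x j) ^+ 2 =
  (#|P|%:R * \sum_(i | P i) x i ^+ 2 - (\sum_(i | P i) x i) ^+ 2) *+ 2.
Proof.
transitivity (\sum_(i | P i) (#|P|%:R * x i ^+ 2 + \sum_(j | P j) x j ^+ 2
   - x i * (\sum_(j | P j) x j) *+ 2)).
  apply: eq_bigr => i Pi; rewrite mulr_sumr -sumrMnl mulr_natl.
  rewrite -[X in X + _ - _]sumr_const -big_split -sumrB /=.
  by apply: eq_bigr => j _; ring.
rewrite sumrB big_split /= -mulr_sumr sumr_const sumrMnl -mulr_suml -mulr_natl.
by ring.
Qed.

Lemma sqr_sum_le (R : realFieldType) (I : finType) (P : pred I) (x : I -> R) :
  (\sum_(i | P i) x i) ^+ 2 <= #|P|%:R * \sum_(i | P i) x i ^+ 2.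
Proof.
have : 0 <= (#|P|%:R * \sum_(i | P i) x i ^+ 2 - (\sum_(i | P i) x i) ^+ 2) *+ 2.
  by rewrite -sum_pair_sqrB; do 2![apply: sumr_ge0 => ? _]; exact: sqr_ge0.
by rewrite pmulrn_lge0 // subr_ge0.
Qed.

Lemma sum_sqrB (R : realFieldType) (I : finType) (P : pred I) (x : I -> R) (c : R) :
  \sum_(i | P i) (x i - c) ^+ 2 =
  \sum_(i | P i) x i ^+ 2 - 2 * c * (\sum_(i | P i) x i) + #|P|%:R * c ^+ 2.
Proof.
rewrite [#|P|%:R * _]mulr_natl -sumr_const mulr_sumr -sumrB -big_split /=.
by apply: eq_bigr => i _; ring.
Qed.

(** This U-statistic form removes the random centre, so that expectations reduce to inclusion
    probabilities of pairs. *)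
Lemma sum_sqr_meanB (R : realFieldType) (I : finType) (P : pred I) (x : I -> R) (n : R) :
  #|P|%:R = n -> n != 0 ->
  \sum_(i | P i) (x i - n^-1 * \sum_(j | P j) x j) ^+ 2 =
  (2 * n)^-1 * \sum_(i | P i) \sum_(j | P j) (x i - x j) ^+ 2.
Proof.
by move=> <- n0; rewrite sum_sqrB sum_pair_sqrB -mulr_natl; field.
Qed.

(** The two sides differ by [#|P|] times the squared distance from [c] to the mean. *)
Lemma sum_sqr_meanB_le (R : realFieldType) (I : finType) (P : pred I) (x : I -> R) (n c : R) :
  #|P|%:R = n -> n != 0 ->
  \sum_(i | P i) (x i - n^-1 * \sum_(j | P j) x j) ^+ 2 <= \sum_(i | P i) (x i - c) ^+ 2.
Proof.
move=> <- n0; rewrite !sum_sqrB -subr_ge0.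
set a := \sum_(i | P i) x i ^+ 2; set b := \sum_(i | P i) x i.
rewrite [leRHS](_ : _ = #|P|%:R * (c - #|P|%:R^-1 * b) ^+ 2); last by field.
by rewrite mulr_ge0 // sqr_ge0.
Qed.

Lemma sqr_mean_le (R : realFieldType) (I : finType) (P : pred I) (x : I -> R) (n : R) :
  #|P|%:R = n -> n != 0 ->
  (n^-1 * \sum_(i | P i) x i) ^+ 2 <= n^-1 * \sum_(i | P i) x i ^+ 2.
Proof.
move=> <- n0; rewrite exprMn expr2 -mulrA ler_wpM2l ?invr_ge0 //.
by rewrite ler_pdivrMl ?sqr_sum_le // lt0r n0 ler0n.
Qed.

(** * Poincare inequality for random transpositions *)

Section Poincare.
Variables (R : realFieldType) (T C : finType).
Implicit Types (z : {ffun T -> C}) (s t : {perm T}) (A B : {set T}).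

Definition relabel z s : {ffun T -> C} := [ffun i => z (s i)].

Lemma relabelM z s t : relabel (relabel z s) t = relabel z (t * s)%g.
Proof. by apply/ffunP => i; rewrite !ffunE permM. Qed.

Lemma relabel1 z : relabel z 1%g = z.
Proof. by apply/ffunP => i; rewrite !ffunE perm1. Qed.

Variable V : {set {ffun T -> C}}.
Hypothesis V_relabel : forall z s, z \in V -> relabel z s \in V.

Lemma mem_relabel z s : (relabel z s \in V) = (z \in V).
Proof.
apply/idP/idP => [h|]; last exact: V_relabel.
by have := V_relabel s^-1%g h; rewrite relabelM mulVg relabel1.
Qed.

Lemma sum_relabel (h : {ffun T -> C} -> R) s :
  \sum_(z in V) h (relabel z s) = \sum_(z in V) h z.
Proof.
rewrite [RHS](reindex_onto (relabel^~ s) (relabel^~ s^-1%g)) /=; last first.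
  by move=> z _; rewrite relabelM mulgV relabel1.
by apply: eq_bigl => z; rewrite mem_relabel relabelM mulVg relabel1 eqxx andbT.
Qed.

Variable f : {ffun T -> C} -> R.

(** For [z] uniform on an invariant set, this is the conditional expectation of [f] given the labels
    off [A] and the multiset of labels on [A]. *)
Definition orbit_avg A z : R := #|Sym A|%:R^-1 * \sum_(s in Sym A) f (relabel z s).

(** One term of the Dirichlet form of the transposition walk, not normalized by [#|V|]. *)
Definition swap_energy i j : R :=
  \sum_(z in V) (f (relabel z (tperm i j)) - f z) ^+ 2.

Lemma swap_energy_ge0 i j : 0 <= swap_energy i j.
Proof. by apply: sumr_ge0 => z _; exact: sqr_ge0. Qed.

Lemma swap_energy_id i : swap_energy i i = 0.
Proof. by apply: big1 => z _; rewrite tperm1 relabel1 subrr expr0n. Qed.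

Lemma card_SymE A : #|Sym A| = (#|A|)`!.
Proof. by rewrite -card_perm; apply: eq_card => s; rewrite inE. Qed.

Lemma card_Sym_neq0 A : #|Sym A|%:R != 0 :> R.
Proof. by rewrite card_SymE pnatr_eq0 -lt0n fact_gt0. Qed.

Lemma orbit_avg_inv A s z : s \in Sym A -> orbit_avg A (relabel z s) = orbit_avg A z.
Proof.
move=> sA; congr (_ * _).
rewrite [RHS](reindex_inj (mulIg s)) /=.
by apply: eq_big => t; rewrite ?groupMr // relabelM.
Qed.

Lemma Sym_sub A B s : B \subset A -> s \in Sym B -> s \in Sym A.
Proof. by rewrite !inE => /subsetP BA /subsetP sB; apply/subsetP => x /sB/BA. Qed.

(** Orthogonality of a conditional expectation: relabelling by each [s] in [Sym A] preserves the sum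
    over [V] and leaves [u] unchanged. *)
Lemma orbit_avg_adj A (u : {ffun T -> C} -> R) :
  (forall z s, s \in Sym A -> u (relabel z s) = u z) ->
  \sum_(z in V) (f z - orbit_avg A z) * u z = 0.
Proof.
move=> uA; under eq_bigr do rewrite mulrBl.
rewrite sumrB; apply/eqP; rewrite subr_eq0; apply/eqP.
transitivity (#|Sym A|%:R^-1 * \sum_(s in Sym A) \sum_(z in V) f z * u z).
  by rewrite sumr_const -[X in _ * X]mulr_natl mulKf // card_Sym_neq0.
under [RHS]eq_bigr do rewrite /orbit_avg -mulrA mulr_suml.
rewrite -mulr_sumr [in RHS]exchange_big /=; congr (_ * _); apply: eq_bigr => s sA.
by rewrite -(sum_relabel _ s); apply: eq_bigr => z _; rewrite uA.
Qed.

(** Coset decomposition: [s] is determined by [l = s i] and by [s * tperm i l], which fixes [i]. *)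
Lemma sum_Sym (A : {set T}) i (h : {perm T} -> R) : i \in A ->
  \sum_(s in Sym A) h s =
  \sum_(l in A) \sum_(s in Sym (A :\ i)) h (s * tperm i l)%g.
Proof.
move=> iA; rewrite (partition_big (fun s : {perm T} => s i) (mem A)) /=; last first.
  by move=> s; rewrite inE => sA; rewrite perm_closed.
apply: eq_bigr => l lA.
rewrite (reindex_inj (mulIg (tperm i l))) /=; apply: eq_bigl => s.
have tA : tperm i l \in Sym A.
  rewrite inE; apply/subsetP => x; rewrite inE; case: tpermP => [->|->|] //.
  by rewrite eqxx.
rewrite groupMr // permM -{2}(tpermL i l) (inj_eq perm_inj) !inE.
apply/andP/subsetP => [[/subsetP sA /eqP si] x|sA].
  by rewrite !inE => sx; rewrite (sA x) ?inE // andbT; apply: contraNneq sx => ->; rewrite si.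
have si : s i = i by apply/eqP; apply: contraT => /sA; rewrite !inE eqxx.
by split; [apply/subsetP => x /sA; rewrite !inE => /andP[]|apply/eqP].
Qed.

Lemma orbit_avg_step A i z : i \in A ->
  orbit_avg A z = #|A|%:R^-1 * \sum_(l in A) orbit_avg (A :\ i) (relabel z (tperm i l)).
Proof.
move=> iA; rewrite /orbit_avg (sum_Sym _ iA) -mulr_sumr mulrA; congr (_ * _); last first.
  by apply: eq_bigr => l lA; apply: eq_bigr => s _; rewrite relabelM.
rewrite -invfM -natrM; congr (_%:R^-1).
by rewrite !card_SymE (cardsD1 i A) iA add1n factS mulnC.
Qed.

(* Conjugating by [s], which fixes [i], turns the swap of [i] and [l] after [s] into
   the swap of [i] and [s^-1 l] before it; the bijection [l -> s^-1 l] of [A] then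
   makes the average over [s] disappear. *)
Lemma orbit_avg_diff A i : i \in A ->
  \sum_(z in V) (orbit_avg (A :\ i) z - orbit_avg A z) ^+ 2
    <= #|A|%:R^-1 * \sum_(l in A) swap_energy i l.
Proof.
move=> iA.
have nA : #|A|%:R != 0 :> R by rewrite pnatr_eq0 -lt0n (cardD1 i) iA.
set B := A :\ i; have nS := card_Sym_neq0 B.
have step z : (orbit_avg B z - orbit_avg A z) ^+ 2 <=
  #|A|%:R^-1 * \sum_(l in A) (#|Sym B|%:R^-1 * \sum_(s in Sym B)
    (f (relabel (relabel z s) (tperm i (s^-1%g l))) - f (relabel z s)) ^+ 2).
  rewrite (orbit_avg_step _ iA).
  have -> : orbit_avg B z = #|A|%:R^-1 * \sum_(l in A) orbit_avg B z.
    by rewrite sumr_const -[X in _ * X]mulr_natl mulKf.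
  rewrite -mulrBr -sumrB; apply: le_trans (sqr_mean_le _ (erefl _) nA) _.
  apply: ler_wpM2l; first by rewrite invr_ge0.
  apply: ler_sum => l lA; rewrite -mulrBr -sumrB.
  apply: le_trans (sqr_mean_le _ (erefl _) nS) _.
  apply: ler_wpM2l; first by rewrite invr_ge0.
  apply: ler_sum => s sB; rewrite -sqrrN opprB !relabelM.
  suff -> : (s * tperm i l = tperm i (s^-1 l) * s)%g by [].
  have si : s^-1%g i = i.
    have := groupVr sB; rewrite inE => /subsetP sB'.
    by apply/eqP; apply: contraT => /sB'; rewrite !inE eqxx.
  by rewrite -{2}si -tpermJ conjgE invgK !mulgA mulgKV.
apply: le_trans (ler_sum _ (fun z _ => step z)) _.
rewrite -mulr_sumr; apply: ler_wpM2l; first by rewrite invr_ge0.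
rewrite exchange_big /=.
under eq_bigr => l _ do rewrite -mulr_sumr exchange_big /=.
rewrite -mulr_sumr exchange_big /=.
rewrite (eq_bigr (fun=> \sum_(l in A) swap_energy i l)) => [|s sB]; last first.
  rewrite [RHS](reindex_inj (@perm_inj _ s^-1%g)) /=.
  apply: eq_big => l.
    have := groupVr (Sym_sub (subsetDl A [set i]) sB).
    by rewrite inE => sA; rewrite (perm_closed l sA).
  by move=> lA; rewrite /swap_energy -[RHS](sum_relabel _ s).
by rewrite sumr_const -[X in _ * X]mulr_natl mulKf.
Qed.

(** Both averages are invariant under [Sym (A :\ i)], so the residual of the finer one is orthogonal
    to their difference. *)
Lemma orbit_avg_pythagoras A i : i \in A ->
  \sum_(z in V) (f z - orbit_avg A z) ^+ 2 =
  \sum_(z in V) (f z - orbit_avg (A :\ i) z) ^+ 2 +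
  \sum_(z in V) (orbit_avg (A :\ i) z - orbit_avg A z) ^+ 2.
Proof.
move=> iA.
have cross : \sum_(z in V) (f z - orbit_avg (A :\ i) z) *
    (orbit_avg (A :\ i) z - orbit_avg A z) = 0.
  apply: orbit_avg_adj => z s sB.
  by rewrite !orbit_avg_inv // (Sym_sub _ sB) // subsetDl.
transitivity (\sum_(z in V) ((f z - orbit_avg (A :\ i) z) ^+ 2 +
    (orbit_avg (A :\ i) z - orbit_avg A z) ^+ 2 +
    2 * ((f z - orbit_avg (A :\ i) z) * (orbit_avg (A :\ i) z - orbit_avg A z)))).
  by apply: eq_bigr => z _; ring.
by rewrite !big_split /= -mulr_sumr cross mulr0 addr0.
Qed.

Theorem poincare_relabel A :
  #|A|%:R * \sum_(z in V) (f z - orbit_avg A z) ^+ 2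
    <= \sum_(i in A) \sum_(j in A) swap_energy i j.
Proof.
move: {2}#|A| (erefl #|A|) => n; elim: n A => [|n IH] A cA.
  by rewrite cA mul0r; do 2![apply: sumr_ge0 => ? _]; exact: swap_energy_ge0.
set S := \sum_(i in A) \sum_(j in A) _.
have S0 : 0 <= S by do 2![apply: sumr_ge0 => ? _]; exact: swap_energy_ge0.
set v := fun B => \sum_(z in V) (f z - orbit_avg B z) ^+ 2.
(* The Pythagorean split is summed over every choice of [i] in [A], so that each ordered pair enters
   the between-part once. *)
have E1 : #|A|%:R * v A <= \sum_(i in A) v (A :\ i) + n.+1%:R^-1 * S.
  rewrite mulr_natl -sumr_const /S mulr_sumr -big_split /=.
  apply: ler_sum => i iA; rewrite {1}/v (orbit_avg_pythagoras iA) lerD2l.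
  by have := orbit_avg_diff iA; rewrite cA.
have E2 : n%:R * \sum_(i in A) v (A :\ i) <= n.-1%:R * S.
  rewrite mulr_sumr.
  apply: (@le_trans _ _ (\sum_(i in A) \sum_(j in A :\ i) \sum_(k in A :\ i) swap_energy j k)).
    apply: ler_sum => i iA.
    have cB : #|A :\ i| = n by move: cA; rewrite (cardsD1 i A) iA => -[].
    by have := IH _ cB; rewrite cB.
  rewrite (exchange_big_dep (mem A)) /=; last by move=> i j _; rewrite !inE => /andP[_].
  rewrite /S mulr_sumr; apply: ler_sum => j jA.
  rewrite (exchange_big_dep (mem A)) /=; last by move=> i k _; rewrite !inE => /andP[_].
  rewrite mulr_sumr; apply: ler_sum => k kA.
  (* A pair [j != k] survives only in the sets [A :\ i] with [i] different from both, and [A] has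
     [n.-1] such points. *)
  rewrite sumr_const -[leLHS]mulr_natl.
  have [->|jk] := eqVneq j k; first by rewrite swap_energy_id !mulr0 lexx.
  rewrite ler_wpM2r ?swap_energy_ge0 // ler_nat.
  apply: (@leq_trans #|A :\ j :\ k|).
    apply: subset_leq_card; apply/subsetP => i; rewrite unfold_in /= !inE.
    by rewrite jA kA !andbT => /andP[/andP[-> ji] ki]; rewrite ![i == _]eq_sym ki ji.
  have := cardsD1 j A; rewrite jA cA => -[->].
  by rewrite (cardsD1 k (A :\ j)) !inE eq_sym jk kA.
(* The bound [E2] will be divided by [n], so a singleton [A] is treated apart: [Sym A] is then
   trivial and the left side vanishes. *)
have [n0|n0] := posnP n.
  have /eqP/cards1P[i Ai] : #|A| = 1%N by rewrite cA n0.
  rewrite (eq_bigr (fun=> 0)) ?sumr_const ?mul0rn ?mulr0 // => z _.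
  have E : Sym A = [set 1%g].
    apply/eqP; rewrite eq_sym eqEcard cards1 card_SymE cA n0 leqnn andbT sub1set.
    exact: group1.
  by rewrite /orbit_avg E cards1 invr1 mul1r big_set1 relabel1 subrr expr0n.
apply: le_trans E1 _.
have np : 0 < n%:R :> R by rewrite ltr0n.
have Sp : 0 < n.+1%:R :> R by rewrite ltr0n.
apply: (@le_trans _ _ (n%:R^-1 * (n.-1%:R * S) + n.+1%:R^-1 * S)).
  by rewrite lerD2r ler_pdivlMl.
(* The coefficient of [S] is (n-1)/n + 1/(n+1), which is at most 1; this closes the induction
   without loss of constant. *)
rewrite mulrA -mulrDl -[leRHS]mul1r ler_wpM2r //.
have -> : n.-1%:R = n%:R - 1 :> R by rewrite -subn1 natrB.
have : n.+1%:R^-1 <= n%:R^-1 :> R by rewrite lef_pV2 ?posrE // ler_nat.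
by rewrite mulrBr mulr1 mulVf ?gt_eqF //; move: (_^-1) (_^-1) => x y; lra.
Qed.

End Poincare.

(** * Symmetric group action on the valid assignments *)

Section ValidAssign.
Variables (N Q : nat) (Nq : 'I_Q -> nat).
Local Notation V := (valid_assign N Nq).

Lemma valid_relabel (z : {ffun 'I_N -> 'I_Q}) (s : {perm 'I_N}) :
  z \in V -> relabel z s \in V.
Proof.
rewrite !inE => /forallP h; apply/forallP => q.
rewrite -(eqP (h q)) -(card_preimset [set i | z i == q] (@perm_inj _ s)).
by apply/eqP; apply: eq_card => i; rewrite !inE ffunE.
Qed.

Lemma card_valid (z : {ffun 'I_N -> 'I_Q}) q :
  z \in V -> #|[pred i | z i == q]| = Nq q.
Proof.
rewrite inE => /forallP/(_ q)/eqP <-.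
by apply: eq_card => i; rewrite !inE.
Qed.

Lemma count_mem_codom (z : {ffun 'I_N -> 'I_Q}) q :
  count_mem q [tuple z i | i < N] = #|[pred i | z i == q]|.
Proof.
rewrite count_map -sum1_count big_enum_cond /= sum1_card.
by apply: eq_card => i; rewrite !inE.
Qed.

(** Equal group sizes mean equal multisets of labels, so the two label tuples are permutations of
    each other. *)
Lemma valid_transitive (z w : {ffun 'I_N -> 'I_Q}) :
  z \in V -> w \in V -> exists s : {perm 'I_N}, w = relabel z s.
Proof.
move=> zV wV.
have /tuple_permP[s ws] : perm_eq [tuple w i | i < N] [tuple z i | i < N].
  by apply/allP => q _ /=; rewrite !count_mem_codom !card_valid.
exists s; apply/ffunP => i; rewrite ffunE.
have := congr1 (fun t : N.-tuple 'I_Q => tnth t i) (val_inj ws).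
by rewrite !tnth_mktuple.
Qed.

Lemma valid_nonempty : (\sum_q Nq q = N)%N -> exists z, z \in V.
Proof.
(* The witness lists the labels in consecutive blocks of lengths [Nq q]. *)
move=> sN; pose t := flatten [seq nseq (Nq q) q | q <- enum 'I_Q].
have st : size t == N.
  rewrite size_flatten /shape -map_comp sumnE big_map -[X in _ == X]sN big_enum /=.
  by apply/eqP; apply: eq_bigr => q _; rewrite size_nseq.
exists [ffun i => tnth (Tuple st) i]; rewrite inE; apply/forallP => q.
apply/eqP; transitivity (count_mem q t).
  rewrite -[in RHS](_ : tval (Tuple st) = t) // -[in RHS]map_tnth_enum.
  rewrite count_map -sum1_count big_enum_cond /= sum1_card.
  by apply: eq_card => i; rewrite !inE ffunE.
rewrite count_flatten -map_comp sumnE big_map big_enum /= (bigD1 q) //=.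
rewrite count_nseq /= eqxx mul1n big1 ?addn0 // => p /negbTE pq.
by rewrite count_nseq /= pq.
Qed.

End ValidAssign.

(** * Expectations, inclusion probabilities and unbiasedness of the sample variances *)

Section Moments.
Variables (R : realType) (N Q : nat) (Nq : 'I_Q -> nat).
Hypothesis sum_Nq : (\sum_q Nq q = N)%N.
Local Notation V := (valid_assign N Nq).

Let VR := @valid_relabel N Q Nq.

Lemma card_valid_neq0 : #|V|%:R != 0 :> R.
Proof.
have [z zV] := valid_nonempty sum_Nq.
by rewrite pnatr_eq0 -lt0n; apply/card_gt0P; exists z.
Qed.

Lemma sum_valid_group (z : {ffun 'I_N -> 'I_Q}) q :
  z \in V -> \sum_i (z i == q)%:R = (Nq q)%:R :> R.
Proof.
move=> zV; rewrite -(card_valid q zV) -sum1_card natr_sum [RHS]big_mkcond.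
by apply: eq_bigr => i _; rewrite inE; case: eqP.
Qed.

(** By transitivity the full orbit average is constant on [V], and averaging over orbits preserves
    the total of [f]. This turns the Poincare inequality into a variance bound. *)
Lemma orbit_avg_setT (f : {ffun 'I_N -> 'I_Q} -> R) z :
  z \in V -> orbit_avg f [set: 'I_N] z = Expect Nq f.
Proof.
move=> zV.
have E w : w \in V -> orbit_avg f setT w = orbit_avg f setT z.
  move=> wV; have [s ->] := valid_transitive zV wV.
  by rewrite orbit_avg_inv // inE; apply/subsetP => i; rewrite inE.
have S : \sum_(w in V) orbit_avg f setT w = \sum_(w in V) f w.
  rewrite -mulr_sumr exchange_big /=.
  under eq_bigr do rewrite (sum_relabel VR).
  by rewrite sumr_const -[X in _ * X]mulr_natl mulKf // card_Sym_neq0.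
rewrite /Expect -S (eq_bigr _ E) sumr_const -[_ *+ _]mulr_natl mulrC mulKf //.
exact: card_valid_neq0.
Qed.

Lemma variance_le_swap (f : {ffun 'I_N -> 'I_Q} -> R) :
  N%:R * \sum_(z in V) (f z - Expect Nq f) ^+ 2 <= \sum_i \sum_j swap_energy V f i j.
Proof.
have := @poincare_relabel R _ _ _ VR f setT.
rewrite cardsT card_ord (eq_bigr (fun z => (f z - Expect Nq f) ^+ 2)); last first.
  by move=> z zV; rewrite orbit_avg_setT.
move=> /le_trans; apply.
rewrite le_eqVlt; apply/orP; left; apply/eqP.
by under eq_bigl do rewrite inE; apply: eq_bigr => i _; under eq_bigl do rewrite inE.
Qed.

(** Symmetry makes the inclusion probability of a unit the same for all units, and counting group
    [q] fixes it at [Nq q / N]. *)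
Lemma sum_marginal1 q (g : 'I_N -> R) :
  N%:R * \sum_(z in V) \sum_(k | z k == q) g k = #|V|%:R * (Nq q)%:R * \sum_k g k.
Proof.
pose p k : R := \sum_(z in V) (z k == q)%:R.
have pk k : N%:R * p k = #|V|%:R * (Nq q)%:R.
  transitivity (\sum_l p l).
    rewrite (eq_bigr (fun=> p k)) ?sumr_const ?card_ord ?mulr_natl // => l _.
    rewrite /p -(sum_relabel VR _ (tperm l k)).
    by apply: eq_bigr => z _; rewrite ffunE tpermL.
  rewrite exchange_big /= (eq_bigr (fun=> (Nq q)%:R)) ?sumr_const ?mulr_natl //.
  by move=> z; exact: sum_valid_group.
transitivity (N%:R * \sum_k p k * g k).
  congr (_ * _); under eq_bigr do rewrite big_mkcond.
  rewrite exchange_big /=; apply: eq_bigr => k _; rewrite mulr_suml.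
  by apply: eq_bigr => z _; case: eqP => _; rewrite ?mul1r ?mul0r.
by rewrite !mulr_sumr; apply: eq_bigr => k _; rewrite mulrA pk.
Qed.

(** Same argument for ordered pairs of distinct units; vanishing of [g] on the diagonal leaves only
    those pairs. *)
Lemma sum_marginal2 q (g : 'I_N -> 'I_N -> R) : (forall k, g k k = 0) ->
  N%:R * (N%:R - 1) * \sum_(z in V) \sum_(k | z k == q) \sum_(l | z l == q) g k l
  = #|V|%:R * ((Nq q)%:R * ((Nq q)%:R - 1)) * \sum_k \sum_l g k l.
Proof.
move=> g0.
pose p k l : R := \sum_(z in V) (z k == q)%:R * (z l == q)%:R.
have pkl k l : k != l ->
    N%:R * (N%:R - 1) * p k l = #|V|%:R * ((Nq q)%:R * ((Nq q)%:R - 1)).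
  move=> kl; transitivity (\sum_i \sum_(j | j != i) p i j).
    have pc i j : j != i -> p i j = p k l.
      (* The permutation [s] carries the pair [(i, j)] to [(k, l)]: first [i] to [k], then the image
         of [j] to [l], keeping [k] in place. *)
      move=> ji; pose t := tperm i k; pose s := (t * tperm (t j) l)%g.
      have si : s i = k.
        rewrite permM tpermL tpermD // 1?eq_sym //.
        by rewrite -(tpermL i k) (inj_eq perm_inj) eq_sym.
      have sj : s j = l by rewrite permM tpermL.
      rewrite /p -(sum_relabel VR _ s).
      by apply: eq_bigr => z _; rewrite !ffunE si sj.
    under eq_bigr => i _ do rewrite (eq_bigr _ (pc i)) sumr_const cardC1 card_ord.
    rewrite sumr_const card_ord -mulrnA -[RHS]mulr_natl natrM; congr (_ * _).
    rewrite mulrC; congr (_ * _); rewrite -subn1 natrB //.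
    exact: leq_ltn_trans (ltn_ord k).
  transitivity (\sum_(z in V) ((Nq q)%:R * ((Nq q)%:R - 1)) : R).
    under eq_bigr do rewrite exchange_big.
    rewrite exchange_big /=; apply: eq_bigr => z zV.
    under eq_bigr => i _ do rewrite -mulr_sumr.
    rewrite -{1}(sum_valid_group q zV) mulr_suml; apply: eq_bigr => i _.
    case: (z i =P q) => [zi|]; rewrite ?mul0r // !mul1r.
    by rewrite -(sum_valid_group q zV) [in RHS](bigD1 i) //= zi eqxx addrAC subrr add0r.
  by rewrite sumr_const [RHS]mulr_natl.
transitivity (N%:R * (N%:R - 1) * \sum_k \sum_l p k l * g k l).
  congr (_ * _); under eq_bigr do rewrite big_mkcond.
  rewrite exchange_big /=; apply: eq_bigr => k _.
  under [RHS]eq_bigr do rewrite mulr_suml.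
  rewrite [RHS]exchange_big /=; apply: eq_bigr => z _.
  case: (z k =P q) => _; last by rewrite big1 // => l _; rewrite !mul0r.
  rewrite big_mkcond; apply: eq_bigr => l _.
  by case: eqP => _; rewrite ?mul0r ?mulr0 ?mul0r // !mul1r.
rewrite !mulr_sumr; apply: eq_bigr => k _; rewrite !mulr_sumr; apply: eq_bigr => l _.
have [<-|kl] := eqVneq k l; first by rewrite g0 !mulr0.
by rewrite [LHS]mulrA pkl.
Qed.

Variable Y : 'I_N -> 'I_Q -> R.
Hypothesis Nq_ge2 : forall q, (2 <= Nq q)%N.

Lemma Nq_neq0 q : (Nq q)%:R != 0 :> R.
Proof. by rewrite pnatr_eq0 -lt0n (leq_trans _ (Nq_ge2 q)). Qed.

Lemma Nq1_gt0 q : 0 < (Nq q)%:R - 1 :> R.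
Proof. by rewrite subr_gt0 ltr1n. Qed.

Lemma Nq_le q : (Nq q <= N)%N.
Proof. by rewrite -sum_Nq (bigD1 q) //= leq_addr. Qed.

Definition group_ss q (z : {ffun 'I_N -> 'I_Q}) : R :=
  \sum_(i | z i == q) (Y i q - Yhat Nq Y z q) ^+ 2.

Lemma YhatE z q : Yhat Nq Y z q = (Nq q)%:R^-1 * \sum_(i | z i == q) Y i q.
Proof. by congr (_ * _); apply: eq_bigr => i /eqP <-. Qed.

Lemma ShatE z q : Shat Nq Y z q = ((Nq q)%:R - 1)^-1 * group_ss q z.
Proof. by congr (_ * _); apply: eq_bigr => i /eqP zi; rewrite /obs zi. Qed.

Lemma Expect_Shat q : Expect Nq (fun z => Shat Nq Y z q) = Smat Y q q.
Proof.
have N2 : (2 <= N)%N := leq_trans (Nq_ge2 q) (Nq_le q).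
have N0 : N%:R != 0 :> R by rewrite pnatr_eq0 -lt0n (leq_trans _ N2).
have N1 : N%:R - 1 != 0 :> R by rewrite gt_eqF // subr_gt0 ltr1n.
have q0 := Nq_neq0 q; have q1 := lt0r_neq0 (Nq1_gt0 q); have v0 := card_valid_neq0.
pose g k l := (Y k q - Y l q) ^+ 2.
rewrite mxE.
rewrite (eq_bigr (fun i => (Y i q - N%:R^-1 * \sum_j Y j q) ^+ 2)); last first.
  by move=> i _; rewrite expr2.
rewrite (@sum_sqr_meanB R _ predT (Y^~ q)) ?card_ord //.
have H := @sum_marginal2 q g.
rewrite /Expect (eq_bigr (fun z : {ffun _ -> _} => (2 * (Nq q)%:R * ((Nq q)%:R - 1))^-1 *
   \sum_(k | z k == q) \sum_(l | z l == q) g k l)); last first.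
  move=> z zV; rewrite ShatE /group_ss YhatE.
  rewrite (@sum_sqr_meanB R _ (fun i => z i == q) (Y^~ q)) //; last by rewrite -(card_valid q zV).
  by rewrite mulrA -invfM; congr (_^-1 * _); ring.
rewrite -mulr_sumr; set A := \sum_(z in V) _ in H *; set B := \sum_k _ in H *.
have {}H : A = #|V|%:R * ((Nq q)%:R * ((Nq q)%:R - 1)) * B / (N%:R * (N%:R - 1)).
  rewrite -H; last by move=> k; rewrite /g subrr expr0n.
  by rewrite mulrAC mulfV ?mul1r // mulf_neq0.
by rewrite H -/B; field; rewrite q0 q1 v0 N0 N1.
Qed.

End Moments.

(** * Effect of one swap on the group sums of squares *)

Section Swap.
Variables (R : realType) (N Q : nat) (Nq : 'I_Q -> nat) (Y : 'I_N -> 'I_Q -> R).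
Hypothesis sum_Nq : (\sum_q Nq q = N)%N.
Hypothesis Nq_ge2 : forall q, (2 <= Nq q)%N.
Local Notation V := (valid_assign N Nq).
Implicit Types (z : {ffun 'I_N -> 'I_Q}) (q : 'I_Q) (i j : 'I_N).

Let q0 q : (Nq q)%:R != 0 :> R := Nq_neq0 R Nq_ge2 q.

Lemma card_groupR z q : z \in V -> #|fun i => z i == q|%:R = (Nq q)%:R :> R.
Proof. by move=> zV; rewrite -(card_valid q zV). Qed.

Definition dev4 i q : R := (Y i q - Ybar Y q) ^+ 4.

Definition group_dev4 q z : R := (Nq q)%:R^-1 * \sum_(k | z k == q) dev4 k q.

Lemma dev4_ge0 i q : 0 <= dev4 i q.
Proof. by rewrite /dev4 (exprM _ 2 2) sqr_ge0. Qed.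

Lemma group_dev4_ge0 q z : 0 <= group_dev4 q z.
Proof. by rewrite mulr_ge0 ?invr_ge0 // sumr_ge0 // => k _; exact: dev4_ge0. Qed.

(** Jensen's inequality for the square, applied twice. *)
Lemma Yhat_dev4 z q : z \in V -> (Yhat Nq Y z q - Ybar Y q) ^+ 4 <= group_dev4 q z.
Proof.
move=> zV; have cq := card_groupR q zV.
have -> : Yhat Nq Y z q - Ybar Y q =
    (Nq q)%:R^-1 * \sum_(k | z k == q) (Y k q - Ybar Y q).
  by rewrite YhatE sumrB sumr_const -[_ *+ #|_|]mulr_natl cq mulrBr mulKf.
rewrite (exprM _ 2 2).
apply: (@le_trans _ _ (((Nq q)%:R^-1 * \sum_(k | z k == q) (Y k q - Ybar Y q) ^+ 2) ^+ 2)).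
  rewrite ler_sqr ?nnegrE ?sqr_ge0 ?(sqr_mean_le _ cq) //.
  by rewrite mulr_ge0 ?invr_ge0 // sumr_ge0 // => k _; exact: sqr_ge0.
apply: le_trans (sqr_mean_le _ cq (q0 q)) _.
by under eq_bigr do rewrite -exprM.
Qed.

Lemma pow4B_le (u v : R) : (u - v) ^+ 4 <= 8 * (u ^+ 4 + v ^+ 4).
Proof.
have h1 : (u - v) ^+ 2 <= 2 * (u ^+ 2 + v ^+ 2).
  rewrite -subr_ge0 [leRHS](_ : _ = (u + v) ^+ 2) ?sqr_ge0 //; by ring.
rewrite (exprM _ 2 2); apply: (@le_trans _ _ ((2 * (u ^+ 2 + v ^+ 2)) ^+ 2)).
  by rewrite ler_sqr ?nnegrE ?sqr_ge0 // (le_trans _ h1) ?sqr_ge0.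
rewrite -subr_ge0 [leRHS](_ : _ = 4 * (u ^+ 2 - v ^+ 2) ^+ 2); last by ring.
by rewrite mulr_ge0 ?sqr_ge0.
Qed.

Lemma relabel_tperm_id z i j : z i = z j -> relabel z (tperm i j) = z.
Proof. by move=> zij; apply/ffunP => k; rewrite ffunE; case: tpermP => [->|->|]. Qed.

Lemma relabel_tpermK z i j : relabel (relabel z (tperm i j)) (tperm i j) = z.
Proof. by rewrite relabelM tperm2 relabel1. Qed.

(* The sample mean of the old group is only a suboptimal centre for the new one. *)
Lemma group_ss_swap_le z q i j : z \in V -> z i = q -> z j != q ->
  group_ss Nq Y q (relabel z (tperm i j)) <=
  group_ss Nq Y q z + (Y j q - Yhat Nq Y z q) ^+ 2.
Proof.
move=> zV zi zj; have zV' := valid_relabel (tperm i j) zV.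
rewrite {1}/group_ss YhatE.
apply: le_trans (sum_sqr_meanB_le (Y^~ q) (Yhat Nq Y z q) (card_groupR q zV') (q0 q)) _.
rewrite (reindex_inj (@perm_inj _ (tperm i j))) /=.
under eq_bigl do rewrite ffunE tpermK.
rewrite /group_ss (bigD1 i) ?zi //= tpermL [in leRHS](bigD1 i) ?zi //=.
rewrite addrC lerD2r -[leLHS]add0r lerD ?sqr_ge0 //.
apply: ler_sum => k /andP[zk ki]; rewrite tpermD // eq_sym //.
by apply: contraNneq zj => <-.
Qed.

(** The one-sided bound is used at [z] and at the swapped assignment, a swap being an involution;
    together they bound the absolute change. The indicator factor records that group [q] is affected
    only if it contains [i] or [j]. *)
Lemma group_ss_swap_sqr z q i j : z \in V ->
  (group_ss Nq Y q (relabel z (tperm i j)) - group_ss Nq Y q z) ^+ 2 <=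
  ((z i == q)%:R + (z j == q)%:R) * (8 * (dev4 i q + dev4 j q +
     group_dev4 q z + group_dev4 q (relabel z (tperm i j)))).
Proof.
have main z' k l : z' \in V -> z' k = q -> z' l != q ->
  (group_ss Nq Y q (relabel z' (tperm k l)) - group_ss Nq Y q z') ^+ 2 <=
  8 * (dev4 k q + dev4 l q +
     group_dev4 q z' + group_dev4 q (relabel z' (tperm k l))).
  move=> zV zk zl; set w := relabel z' (tperm k l).
  have wV : w \in V := valid_relabel (tperm k l) zV.
  have up := group_ss_swap_le zV zk zl; rewrite -/w in up.
  have wl : w l = q by rewrite ffunE tpermR.
  have wk : w k != q by rewrite ffunE tpermL.
  have lo := group_ss_swap_le wV wl wk.
  rewrite tpermC relabel_tpermK in lo.
  have bu : (Y l q - Yhat Nq Y z' q) ^+ 4 <= 8 * (dev4 l q + group_dev4 q z').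
    have := pow4B_le (Y l q - Ybar Y q) (Yhat Nq Y z' q - Ybar Y q).
    rewrite opprB addrA subrK => /le_trans; apply.
    by rewrite ler_wpM2l // lerD2l Yhat_dev4.
  have bl : (Y k q - Yhat Nq Y w q) ^+ 4 <= 8 * (dev4 k q + group_dev4 q w).
    have := pow4B_le (Y k q - Ybar Y q) (Yhat Nq Y w q - Ybar Y q).
    rewrite opprB addrA subrK => /le_trans; apply.
    by rewrite ler_wpM2l // lerD2l Yhat_dev4.
  have := dev4_ge0 k q; have := dev4_ge0 l q.
  have := group_dev4_ge0 q z'; have := group_dev4_ge0 q w.
  move: bu bl lo up; rewrite !(exprM _ 2 2).
  set a := (Y l q - _) ^+ 2; set b := (Y k q - _) ^+ 2 => bu bl lo up g1 g2 d1 d2.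
  have a0 : 0 <= a by exact: sqr_ge0.
  have b0 : 0 <= b by exact: sqr_ge0.
  (* An increase is controlled by the entering unit [l], a decrease by the leaving unit [k]. *)
  case: (lerP (group_ss Nq Y q z') (group_ss Nq Y q w)) => h.
    apply: (@le_trans _ _ (a ^+ 2)); last by lra.
    by rewrite ler_sqr ?nnegrE //; lra.
  apply: (@le_trans _ _ (b ^+ 2)); last by lra.
  by rewrite -sqrrN ler_sqr ?nnegrE //; lra.
move=> zV.
have B0 : 0 <= 8 * (dev4 i q + dev4 j q +
     group_dev4 q z + group_dev4 q (relabel z (tperm i j))).
  by rewrite mulr_ge0 // !addr_ge0 ?dev4_ge0 ?group_dev4_ge0.
have [zi|zi] := eqVneq (z i) q; have [zj|zj] := eqVneq (z j) q.
- by rewrite {1}relabel_tperm_id ?zi ?zj // subrr expr0n mulr_ge0 ?addr_ge0.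
- by rewrite addr0 mul1r main.
- rewrite add0r mul1r tpermC; apply: le_trans (main z j i zV zj zi) _.
  by rewrite [dev4 j q + _]addrC.
rewrite addr0 mul0r (_ : group_ss Nq Y q (relabel z (tperm i j)) = group_ss Nq Y q z).
  by rewrite subrr expr0n.
have E k : (relabel z (tperm i j) k == q) = (z k == q).
  by rewrite ffunE; case: tpermP => [->|->|] //; rewrite (negbTE zi) (negbTE zj).
by rewrite /group_ss (eq_bigl _ _ E); apply: eq_bigr => k _; rewrite !YhatE (eq_bigl _ _ E).
Qed.

(** Exchanging [i] and [j] reduces the two indicators to twice one of them; each of the four
    summands then contributes the same amount [K], whence the factor 8. *)
Lemma sum_swap_dev4 q :
  \sum_i \sum_j \sum_(z in V) ((z i == q)%:R + (z j == q)%:R) *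
     (dev4 i q + dev4 j q + group_dev4 q z + group_dev4 q (relabel z (tperm i j)))
  = 8 * (#|V|%:R * (Nq q)%:R * \sum_k dev4 k q).
Proof.
set K := #|V|%:R * _ * _.
have VR := @valid_relabel N Q Nq.
pose B i j z := dev4 i q + dev4 j q + group_dev4 q z + group_dev4 q (relabel z (tperm i j)).
have E0 : \sum_i \sum_j \sum_(z in V) (z j == q)%:R * B i j z =
          \sum_i \sum_j \sum_(z in V) (z i == q)%:R * B i j z.
  rewrite exchange_big; do 3![apply: eq_bigr => ? _].
  by rewrite /B tpermC [dev4 _ q + _]addrC.
have S3 : \sum_(z in V) \sum_i \sum_(j < N) (z i == q)%:R * group_dev4 q z = K.
  rewrite /K -sum_marginal1 // mulr_sumr; apply: eq_bigr => z zV.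
  under eq_bigr do rewrite sumr_const card_ord -[_ *+ N]mulr_natl.
  rewrite -mulr_sumr -mulr_suml (sum_valid_group _ _ zV) /group_dev4.
  by rewrite mulVKf.
transitivity (2 * \sum_i \sum_j \sum_(z in V) (z i == q)%:R * B i j z).
  rewrite [2 * _]mulr_natl mulr2n -{2}E0 -big_split; apply: eq_bigr => i _.
  rewrite -big_split; apply: eq_bigr => j _; rewrite -big_split.
  by apply: eq_bigr => z _; rewrite mulrDl.
suff -> : \sum_i \sum_j \sum_(z in V) (z i == q)%:R * B i j z = K + K + K + K by ring.
transitivity (\sum_(i < N) \sum_(j < N) \sum_(z in V) (z i == q)%:R * dev4 i q +
  \sum_(i < N) \sum_(j < N) \sum_(z in V) (z i == q)%:R * dev4 j q +
  \sum_(i < N) \sum_(j < N) \sum_(z in V) (z i == q)%:R * group_dev4 q z +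
  \sum_(i < N) \sum_(j < N) \sum_(z in V) (z j == q)%:R * group_dev4 q z).
  rewrite -!big_split /=; apply: eq_bigr => i _; rewrite -!big_split /=; apply: eq_bigr => j _.
  (* Relabelling by the swap turns the fourth summand into the third with the indicator moved from
     [i] to [j]. *)
  rewrite -[X in _ = _ + X](sum_relabel VR _ (tperm i j)) -!big_split /=; apply: eq_bigr => z _ /=.
  by rewrite !ffunE tpermR /B !mulrDr.
congr (_ + _ + _ + _).
- under eq_bigr do rewrite sumr_const card_ord -[_ *+ N]mulr_natl.
  rewrite -mulr_sumr exchange_big /K -sum_marginal1 //; congr (_ * _).
  apply: eq_bigr => z zV; rewrite [RHS]big_mkcond; apply: eq_bigr => i _.
  by case: eqP; rewrite ?mul1r ?mul0r.
- rewrite exchange_big /K mulr_sumr; apply: eq_bigr => j _.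
  rewrite exchange_big (eq_bigr (fun=> (Nq q)%:R * dev4 j q)) => [|z zV].
    by rewrite sumr_const -[LHS]mulr_natl mulrA.
  by rewrite -mulr_suml (sum_valid_group _ _ zV).
- by under eq_bigr do rewrite exchange_big; rewrite exchange_big.
- by rewrite -S3 exchange_big [RHS]exchange_big; apply: eq_bigr => i _; rewrite exchange_big.
Qed.

(** Only the groups [z i] and [z j] can change, so Cauchy-Schwarz costs a factor 2 rather than [Q].
    The constant is 2 from there, 8 from the fourth powers and 8 from [sum_swap_dev4]. *)
Lemma swap_energy_group_ss (kap : 'I_Q -> R) (D : R) :
  (forall q, \sum_k dev4 k q <= N%:R * D) ->
  \sum_i \sum_j swap_energy V (fun z => \sum_q kap q * group_ss Nq Y q z) i j
  <= 128 * (#|V|%:R * (N%:R * D)) * \sum_q kap q ^+ 2 * (Nq q)%:R.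
Proof.
move=> hD.
apply: (@le_trans _ _ (\sum_i \sum_j \sum_(z in V) \sum_q 16 * kap q ^+ 2 *
   (((z i == q)%:R + (z j == q)%:R) *
     (dev4 i q + dev4 j q + group_dev4 q z + group_dev4 q (relabel z (tperm i j)))))).
  apply: ler_sum => i _; apply: ler_sum => j _.
  apply: ler_sum => z zV; rewrite -sumrB.
  set d := fun q => group_ss Nq Y q (relabel z (tperm i j)) - group_ss Nq Y q z.
  rewrite (eq_bigr (fun q => kap q * d q)) => [|q _]; last by rewrite mulrBr.
  pose P := [pred q | (z i == q) || (z j == q)].
  rewrite (bigID P) /= [X in _ + X]big1 ?addr0; last first.
    move=> q; rewrite negb_or => /andP[/negbTE zi /negbTE zj].
    have := group_ss_swap_sqr q i j zV; rewrite zi zj addr0 mul0r -/(d q).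
    (* For a group containing neither unit the bound on the square is 0, hence the change itself is
       0. *)
    by rewrite real_exprn_even_le0 ?num_real //= => /eqP ->; rewrite mulr0.
  apply: le_trans (sqr_sum_le _ _) _.
  apply: (@le_trans _ _ (2 * \sum_q (kap q * d q) ^+ 2)).
    apply: ler_pM; rewrite ?sumr_ge0 //.
    - by move=> q _; exact: sqr_ge0.
    - rewrite ler_nat; apply: (@leq_trans #|[set z i; z j]|).
        by apply: subset_leq_card; apply/subsetP => q; rewrite !inE unfold_in /= ![_ == q]eq_sym.
      by rewrite cards2; case: (_ == _).
    by rewrite big_mkcond; apply: ler_sum => q _; case: ifP => // _; exact: sqr_ge0.
  rewrite mulr_sumr; apply: ler_sum => q _.
  have := group_ss_swap_sqr q i j zV; rewrite -/(d q) => h.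
  rewrite exprMn [leLHS]mulrA.
  rewrite [leRHS](_ : _ = 2 * kap q ^+ 2 * (((z i == q)%:R + (z j == q)%:R) *
     (8 * (dev4 i q + dev4 j q + group_dev4 q z + group_dev4 q (relabel z (tperm i j))))));
    last by ring.
  by rewrite ler_wpM2l // mulr_ge0 ?sqr_ge0.
apply: (@le_trans _ _ (\sum_q 16 * kap q ^+ 2 * (8 * (#|V|%:R * (Nq q)%:R * \sum_k dev4 k q)))).
  rewrite le_eqVlt; apply/orP; left; apply/eqP.
  under [RHS]eq_bigr => q _ do rewrite -sum_swap_dev4 mulr_sumr.
  rewrite [RHS]exchange_big; apply: eq_bigr => i _.
  under [RHS]eq_bigr do rewrite mulr_sumr.
  rewrite [RHS]exchange_big; apply: eq_bigr => j _.
  under [RHS]eq_bigr do rewrite mulr_sumr.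
  by rewrite [RHS]exchange_big.
rewrite mulr_sumr; apply: ler_sum => q _.
rewrite [leLHS](_ : _ = 128 * #|V|%:R * (kap q ^+ 2 * (Nq q)%:R) * \sum_k dev4 k q);
  last by ring.
rewrite [leRHS](_ : _ = 128 * #|V|%:R * (kap q ^+ 2 * (Nq q)%:R) * (N%:R * D)); last by ring.
apply: ler_wpM2l (hD q).
by apply: mulr_ge0; [exact: mulr_ge0|apply: mulr_ge0; [exact: sqr_ge0|]].
Qed.

Lemma variance_group_ss (kap : 'I_Q -> R) (D : R) (f : {ffun 'I_N -> 'I_Q} -> R) :
  (0 < N)%N -> (forall q, \sum_k dev4 k q <= N%:R * D) ->
  f = (fun z => \sum_q kap q * group_ss Nq Y q z) ->
  Expect Nq (fun z => (f z - Expect Nq f) ^+ 2) <= 128 * D * \sum_q kap q ^+ 2 * (Nq q)%:R.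
Proof.
move=> N0 hD fE.
have NR : 0 < N%:R :> R by rewrite ltr0n.
have VR : 0 < #|V|%:R :> R by rewrite lt0r card_valid_neq0 //= ler0n.
rewrite /Expect ler_pdivrMr //.
rewrite -(ler_pM2l NR); apply: le_trans (variance_le_swap sum_Nq f) _.
rewrite {1}fE; apply: le_trans (swap_energy_group_ss kap hD) _.
by rewrite le_eqVlt; apply/orP; left; apply/eqP; ring.
Qed.

End Swap.

(** * Comparison of matrix norms *)

Section MatrixNorms.
Variable R : realType.

Lemma maxnorm_ge0 m n (A : 'M[R]_(m, n)) : 0 <= maxnorm A.
Proof. by apply: (big_ind (fun x => 0 <= x)) => // x y x0 y0; rewrite le_max x0. Qed.

Lemma entry_le_maxnorm m n (A : 'M[R]_(m, n)) i j : `|A i j| <= maxnorm A.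
Proof. exact: (le_bigmax _ (fun ij : 'I_m * 'I_n => `|A ij.1 ij.2|) (i, j)). Qed.

Lemma sqr_maxnorm_le m n (A : 'M[R]_(m, n)) :
  maxnorm A ^+ 2 <= \sum_i \sum_j A i j ^+ 2.
Proof.
have S0 : 0 <= \sum_i \sum_j A i j ^+ 2.
  by do 2![apply: sumr_ge0 => ? _]; exact: sqr_ge0.
apply: (big_ind (fun x : R => x ^+ 2 <= \sum_i \sum_j A i j ^+ 2)).
- by rewrite expr0n.
- by move=> x y hx hy; case: (leP x y).
move=> [i j] _ /=; rewrite real_normK ?num_real // (bigD1 i) //= (bigD1 j) //= -addrA.
rewrite lerDl addr_ge0 ?sumr_ge0 // => *; rewrite ?sumr_ge0 // => *; exact: sqr_ge0.
Qed.

(** Cauchy-Schwarz in each row bounds every squared coordinate by [n * maxnorm A ^ 2], and there are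
    [n] coordinates. *)
Lemma vnorm_mulmx_le n (A : 'M[R]_n) (x : 'cV[R]_n) :
  vnorm x = 1 -> vnorm (A *m x) <= n%:R * maxnorm A.
Proof.
move=> x1; have M0 := maxnorm_ge0 A.
have s1 : \sum_i x i 0 ^+ 2 = 1.
  have s0 : 0 <= \sum_i x i 0 ^+ 2 by apply: sumr_ge0 => i _; exact: sqr_ge0.
  by rewrite -(sqr_sqrtr s0) -/(vnorm x) x1 expr1n.
have nM0 : 0 <= n%:R * maxnorm A by rewrite mulr_ge0.
rewrite /vnorm -[leRHS]ger0_norm // -sqrtr_sqr; apply: ler_wsqrtr.
apply: (@le_trans _ _ (\sum_(i < n) n%:R * maxnorm A ^+ 2)).
  apply: ler_sum => i _; rewrite mxE; apply: le_trans (sqr_sum_le _ _) _.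
  rewrite card_ord ler_wpM2l // -[leRHS]mulr1 -s1 mulr_sumr.
  apply: ler_sum => j _; rewrite exprMn ler_wpM2r ?sqr_ge0 //.
  by rewrite -real_normK ?num_real // ler_sqr ?nnegrE // entry_le_maxnorm.
by rewrite sumr_const card_ord -[leLHS]mulr_natl exprMn expr2 mulrA.
Qed.

Lemma sqr_opnorm_le n (A : 'M[R]_n) : opnorm A ^+ 2 <= (n%:R * maxnorm A) ^+ 2.
Proof.
have nM0 : 0 <= n%:R * maxnorm A by rewrite mulr_ge0 // maxnorm_ge0.
rewrite /opnorm; set E := (X in sup X).
have ubE : ubound E (n%:R * maxnorm A) by move=> _ [x x1 <-]; exact: vnorm_mulmx_le.
(* Without unit vectors, as for [n = 0], the supremum of the empty set is 0 by convention. *)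
have [->|/set0P E0] := eqVneq E classical_sets.set0.
  by rewrite sup0 expr0n sqr_ge0.
(* Comparing squares requires a nonnegative supremum, which any element of [E], being a norm,
   provides. *)
rewrite ler_sqr ?nnegrE //; first exact: ge_sup.
have [y Ey] := E0.
apply: le_trans (ub_le_sup _ Ey); last by exists (n%:R * maxnorm A).
by case: Ey => x _ <-; exact: sqrtr_ge0.
Qed.

End MatrixNorms.

(** * Expectation over assignments and Markov's inequality *)

Section Expectation.
Variables (R : realType) (N Q : nat) (Nq : 'I_Q -> nat).
Local Notation V := (valid_assign N Nq).
Implicit Types f g : {ffun 'I_N -> 'I_Q} -> R.

Lemma ler_Expect f g : (forall z, f z <= g z) -> Expect Nq f <= Expect Nq g.
Proof. by move=> fg; rewrite ler_wpM2r ?invr_ge0 // ler_sum. Qed.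

Lemma eq_Expect f g : f =1 g -> Expect Nq f = Expect Nq g.
Proof. by move=> fg; congr (_ / _); apply: eq_bigr. Qed.

Lemma Expect_sum (I : finType) (h : I -> {ffun 'I_N -> 'I_Q} -> R) :
  Expect Nq (fun z => \sum_i h i z) = \sum_i Expect Nq (h i).
Proof. by rewrite /Expect exchange_big mulr_suml. Qed.

Lemma ExpectZ c f : Expect Nq (fun z => c * f z) = c * Expect Nq f.
Proof. by rewrite /Expect -mulr_sumr mulrA. Qed.

Lemma markov (X : {ffun 'I_N -> 'I_Q} -> R) (K r eps : R) :
  #|V|%:R != 0 :> R -> 0 < K -> 0 < eps -> Expect Nq (fun z => `|X z|) <= K * r ->
  Prob R Nq [pred z | K / eps * r < `|X z|] <= eps.
Proof.
move=> V0 K0 e0 EX; have VR : 0 < #|V|%:R :> R by rewrite lt0r V0 ler0n.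
have S0 : 0 <= \sum_(z in V) `|X z| by exact: sumr_ge0.
have r0 : 0 <= r by rewrite -(pmulr_rge0 _ K0) (le_trans _ EX) // mulr_ge0 // invr_ge0.
rewrite /Prob ler_pdivrMr //; move: EX; rewrite /Expect ler_pdivrMr // => EX.
set A := [set z in V | _].
have AX : #|A|%:R * (K / eps * r) <= \sum_(z in A) `|X z|.
  rewrite mulr_natl -sumr_const; apply: ler_sum => z; rewrite !inE => /andP[_].
  exact: ltW.
have XA : \sum_(z in A) `|X z| <= \sum_(z in V) `|X z|.
  rewrite [leRHS](bigID (mem A)) /= [X in _ <= X + _](_ : _ = \sum_(z in A) `|X z|).
    by rewrite lerDl sumr_ge0.
  by apply: eq_bigl => z; rewrite [z \in A]inE; case: (z \in V).
move: r0; rewrite le_eqVlt => /predU1P[r0|r0].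
  rewrite (_ : A = finset.set0) ?cards0 ?mulr_ge0 ?ltW //.
  apply/setP => z; rewrite in_set0 in_set -r0 mulr0; apply/negP => /andP[zV] /=.
  apply/negP; rewrite -leNgt; move: EX; rewrite -r0 mulr0 mul0r; apply: le_trans.
  by rewrite (bigD1 z) //= lerDl sumr_ge0.
have Kr : 0 < K * r by rewrite mulr_gt0.
rewrite -(ler_pM2l Kr) [K * r * (eps * _)](_ : _ = eps * (K * r * #|V|%:R)); last by ring.
rewrite mulrC -ler_pdivrMl // (le_trans _ EX) // (le_trans _ XA) // (le_trans _ AX) //.
by rewrite le_eqVlt; apply/orP; left; apply/eqP; ring.
Qed.

End Expectation.

(** * Bias and fluctuations of the variance estimator *)

Section VarianceEstimator.
Variables (R : realType) (N Q H : nat) (Nq : 'I_Q -> nat) (Y : 'I_N -> 'I_Q -> R).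
Variable F : 'M[R]_(Q, H).
Hypothesis sum_Nq : (\sum_q Nq q = N)%N.
Hypothesis Nq_ge2 : forall q, (2 <= Nq q)%N.

Lemma sandwich_diagE (d : 'rV[R]_Q) a b :
  (F^T *m diag_mx d *m F) a b = \sum_q F q a * F q b * d 0 q.
Proof.
rewrite mxE; apply: eq_bigr => q _; rewrite mul_mx_diag !mxE; ring.
Qed.

Lemma EVhatE :
  EVhat Nq Y F = F^T *m diag_mx (\row_q ((Nq q)%:R^-1 * Smat Y q q)) *m F.
Proof.
apply/matrixP => a b; rewrite mxE sandwich_diagE.
rewrite (@eq_Expect _ _ _ _ _ (fun z : {ffun _ -> _} =>
  \sum_q (F q a * F q b * (Nq q)%:R^-1) * Shat Nq Y z q)).
  by rewrite Expect_sum; apply: eq_bigr => q _; rewrite ExpectZ Expect_Shat // (mxE _ _ 0 q) mulrA.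
by move=> z; rewrite sandwich_diagE; apply: eq_bigr => q _; rewrite mxE mulrA.
Qed.

Lemma EVhat_ge_Vgamma : loewner_ge (EVhat Nq Y F) (Vgamma Nq Y F).
Proof.
move=> x; pose D : 'M[R]_(N, Q) := \matrix_(i, q) (Y i q - Ybar Y q).
have SD : Smat Y = (N%:R - 1)^-1 *: (D^T *m D).
  apply/matrixP => p q; rewrite !mxE; congr (_ * _).
  by apply: eq_bigr => i _; rewrite !mxE.
(* The diagonal parts cancel, leaving [N^-1 F^T S F] with [S] proportional to the Gram matrix of the
   centred outcomes [D]. *)
rewrite EVhatE /Vgamma /VYhat -mulmxBl -mulmxBr opprB addrC subrK SD.
set u := D *m F *m x.
have -> : x^T *m (F^T *m (N%:R^-1 *: ((N%:R - 1)^-1 *: (D^T *m D))) *m F) *m x =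
    (N%:R^-1 * (N%:R - 1)^-1) *: (u^T *m u).
  by rewrite scalerA -!(scalemxAr, scalemxAl) /u !trmx_mul !mulmxA.
rewrite mxE mulr_ge0 //.
  case: (N) => [|n]; first by rewrite invr0 mul0r.
  by rewrite mulr_ge0 ?invr_ge0 // subr_ge0 ler1n.
by rewrite mxE sumr_ge0 // => i _; rewrite mxE -expr2 sqr_ge0.
Qed.

Variables (cl ch Delta : R).
Hypothesis cl_gt0 : 0 < cl.
Hypothesis cl_le_ch : cl <= ch.
Hypothesis N_gt0 : (0 < N)%N.
Hypothesis Nq_unif : nearly_uniform cl ch Nq.
Hypothesis Y_moment : condition3 Y Delta.

Let NR : 0 < N%:R :> R. Proof. by rewrite ltr0n. Qed.

(** Near uniformity gives [N <= Q * ch * N0] and [Nq q >= cl * N0]; the unknown scale [N0]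
    cancels. *)
Lemma Nq_inv_le q : (Nq q)%:R^-1 <= ch / cl * Q%:R / N%:R :> R.
Proof.
have [N0 [N0_gt0 [c hc]]] := Nq_unif.
have nq : 0 < (Nq q)%:R :> R by rewrite ltr0n (leq_trans _ (Nq_ge2 q)).
rewrite ler_pdivlMr // ler_pdivrMl //.
have [-> [clc cch]] := hc q.
have NE : N%:R = \sum_p c p * N0%:R :> R.
  by rewrite -sum_Nq natr_sum; apply: eq_bigr => p _; have [->] := hc p.
apply: (@le_trans _ _ (\sum_(p < Q) ch * N0%:R)).
  by rewrite NE; apply: ler_sum => p _; have [_ [_ h]] := hc p; rewrite ler_wpM2r.
rewrite sumr_const card_ord -[leLHS]mulr_natl.
have -> : Q%:R * (ch * N0%:R) = cl * (N0%:R * (ch / cl * Q%:R)).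
  by field; rewrite gt_eqF.
rewrite -[leRHS]mulrA ler_wpM2r // mulr_ge0 // mulr_ge0 // divr_ge0 ?(ltW cl_gt0) //.
exact: le_trans (ltW cl_gt0) cl_le_ch.
Qed.

Lemma Vhat_entry_variance a b :
  Expect Nq (fun z => (Vhat Nq Y F z a b - EVhat Nq Y F a b) ^+ 2) <=
  512 * (ch / cl) ^+ 3 * (maxnorm F ^+ 4 * Q%:R ^+ 4 * N%:R ^- 3 * Delta ^+ 4).
Proof.
pose kap q := F q a * F q b * ((Nq q)%:R^-1 * ((Nq q)%:R - 1)^-1).
have fE : (fun z => Vhat Nq Y F z a b) = (fun z => \sum_q kap q * group_ss Nq Y q z).
  apply: functional_extensionality_dep => z; rewrite sandwich_diagE.
  by apply: eq_bigr => q _; rewrite mxE ShatE /kap !mulrA.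
have hD q : \sum_k dev4 Y k q <= N%:R * Delta ^+ 4 by rewrite -ler_pdivrMl //; exact: Y_moment.
rewrite [X in Expect _ X](_ : _ = (fun z => (Vhat Nq Y F z a b -
   Expect Nq (fun z => Vhat Nq Y F z a b)) ^+ 2)); last first.
  by apply: functional_extensionality_dep => z; rewrite [EVhat _ _ _ a b]mxE.
apply: le_trans (variance_group_ss sum_Nq Nq_ge2 N_gt0 hD fE) _.
set t := ch / cl * Q%:R / N%:R.
(* One factor [Nq q] cancels, leaving three inverse sizes, each of order [t]. *)
have kb q : kap q ^+ 2 * (Nq q)%:R <= maxnorm F ^+ 4 * (4 * t ^+ 3).
  have nt := Nq_inv_le q; rewrite -/t in nt.
  have n2 : 2 <= (Nq q)%:R :> R by rewrite ler_nat.
  have n0 : (Nq q)%:R != 0 :> R by rewrite gt_eqF //; lra.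
  have n1 : (Nq q)%:R - 1 != 0 :> R by rewrite gt_eqF //; lra.
  have i0 : 0 <= (Nq q)%:R^-1 :> R by rewrite invr_ge0.
  have j0 : 0 <= ((Nq q)%:R - 1)^-1 :> R by rewrite invr_ge0; lra.
  (* Since [Nq q >= 2], [Nq q - 1] is at least half of [Nq q]. *)
  have jt : ((Nq q)%:R - 1)^-1 <= 2 * t.
    apply: le_trans (_ : 2 * (Nq q)%:R^-1 <= _); last by rewrite ler_pM2l.
    rewrite -[2]invrK -invfM lef_pV2 ?posrE; lra.
  have -> : kap q ^+ 2 * (Nq q)%:R =
    (F q a * F q b) ^+ 2 * ((Nq q)%:R^-1 * ((Nq q)%:R - 1)^-1 ^+ 2).
    by rewrite /kap; field; rewrite n0 n1.
  have -> : 4 * t ^+ 3 = t * (2 * t) ^+ 2 by ring.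
  apply: ler_pM; rewrite ?sqr_ge0 ?mulr_ge0 ?exprn_ge0 //.
    rewrite -real_normK ?num_real // (exprM _ 2 2) ler_sqr ?nnegrE ?sqr_ge0 //.
    by rewrite normrM expr2 ler_pM ?entry_le_maxnorm.
  by apply: ler_pM; rewrite ?exprn_ge0 // lerXn2r ?nnegrE // (le_trans j0 jt).
have D0 : 0 <= Delta ^+ 4 by rewrite (exprM _ 2 2) sqr_ge0.
apply: (@le_trans _ _ (128 * Delta ^+ 4 * \sum_(q < Q) maxnorm F ^+ 4 * (4 * t ^+ 3))).
  by apply: ler_wpM2l; [exact: mulr_ge0|apply: ler_sum => q _; exact: kb].
(* Summing [t ^ 3] over the [Q] groups gives the rate [Q^4 N^-3], and 128 * 4 = 512. *)
rewrite sumr_const card_ord -[_ *+ Q]mulr_natl le_eqVlt; apply/orP; left; apply/eqP.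
by rewrite /t; field; rewrite (gt_eqF NR) (gt_eqF cl_gt0).
Qed.

Lemma Expect_sqr_maxnorm :
  Expect Nq (fun z => maxnorm (Vhat Nq Y F z - EVhat Nq Y F) ^+ 2) <=
  512 * (ch / cl) ^+ 3 *
    (maxnorm F ^+ 4 * Q%:R ^+ 4 * N%:R ^- 3 * Delta ^+ 4 * H%:R ^+ 2).
Proof.
apply: (@le_trans _ _ (Expect Nq (fun z => \sum_a \sum_b
  (Vhat Nq Y F z - EVhat Nq Y F) a b ^+ 2))).
  by apply: ler_Expect => z; exact: sqr_maxnorm_le.
rewrite Expect_sum.
apply: (@le_trans _ _ (\sum_(a < H) \sum_(b < H) 512 * (ch / cl) ^+ 3 *
  (maxnorm F ^+ 4 * Q%:R ^+ 4 * N%:R ^- 3 * Delta ^+ 4))).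
  apply: ler_sum => a _; rewrite Expect_sum; apply: ler_sum => b _.
  apply: le_trans (Vhat_entry_variance a b).
  by apply: ler_Expect => z; rewrite !mxE.
rewrite !sumr_const card_ord -mulrnA -[leLHS]mulr_natl natrM.
by rewrite le_eqVlt; apply/orP; left; apply/eqP; ring.
Qed.

Lemma Expect_sqr_opnorm :
  Expect Nq (fun z => opnorm (Vhat Nq Y F z - EVhat Nq Y F) ^+ 2) <=
  512 * (ch / cl) ^+ 3 *
    (maxnorm F ^+ 4 * Q%:R ^+ 4 * N%:R ^- 3 * Delta ^+ 4 * H%:R ^+ 4).
Proof.
apply: (@le_trans _ _ (Expect Nq (fun z =>
  H%:R ^+ 2 * maxnorm (Vhat Nq Y F z - EVhat Nq Y F) ^+ 2))).
  by apply: ler_Expect => z; rewrite -exprMn; exact: sqr_opnorm_le.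
rewrite ExpectZ; apply: le_trans (ler_wpM2l _ Expect_sqr_maxnorm) _; first exact: sqr_ge0.
by rewrite le_eqVlt; apply/orP; left; apply/eqP; ring.
Qed.

End VarianceEstimator.

Theorem theorem3 (R : realType) (cl ch : R) (Q H N : nat -> nat)
  (Nq : forall k, 'I_(Q k) -> nat)
  (Y : forall k, 'I_(N k) -> 'I_(Q k) -> R)
  (F : forall k, 'M[R]_(Q k, H k))
  (Delta : nat -> R) :
  0 < cl -> cl <= ch ->
  (forall M : nat, exists k0, forall k, (k0 <= k)%N -> (M <= N k)%N) ->
  (forall k, \sum_(q < Q k) Nq k q = N k)%N ->
  (forall k (q : 'I_(Q k)), (2 <= Nq k q)%N) ->
  (forall k, nearly_uniform cl ch (Nq k)) ->
  (forall k, condition3 (Y k) (Delta k)) ->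
  [/\ (forall k, loewner_ge (EVhat (Nq k) (Y k) (F k)) (Vgamma (Nq k) (Y k) (F k))),
      bigOP Nq
        (fun k z => maxnorm (Vhat (Nq k) (Y k) (F k) z - EVhat (Nq k) (Y k) (F k)) ^+ 2)
        (fun k => maxnorm (F k) ^+ 4 * (Q k)%:R ^+ 4 * (N k)%:R ^- 3
                    * Delta k ^+ 4 * (H k)%:R ^+ 2)
    & bigOP Nq
        (fun k z => opnorm (Vhat (Nq k) (Y k) (F k) z - EVhat (Nq k) (Y k) (F k)) ^+ 2)
        (fun k => maxnorm (F k) ^+ 4 * (Q k)%:R ^+ 4 * (N k)%:R ^- 3
                    * Delta k ^+ 4 * (H k)%:R ^+ 4)].
Proof.
move=> cl0 clch Ninf sumN N2 unif c3.
have K0 : 0 < 512 * (ch / cl) ^+ 3 :> R.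
  by rewrite mulr_gt0 // exprn_gt0 // divr_gt0 // (lt_le_trans cl0).
(* From [k0] on there is at least one unit, as the expectation bounds require; the same [k0] serves
   every [eps]. *)
have [k0 hk0] := Ninf 1%N.
split=> [k|eps eps0|eps eps0]; first exact: EVhat_ge_Vgamma.
- exists (512 * (ch / cl) ^+ 3 / eps), k0 => k /hk0 Nk.
  apply: markov => //; first exact: card_valid_neq0.
  rewrite (@eq_Expect _ _ _ _ _ (fun z : {ffun _ -> _} => maxnorm (Vhat (Nq k) (Y k) (F k) z -
    EVhat (Nq k) (Y k) (F k)) ^+ 2)); last by move=> z; rewrite ger0_norm ?sqr_ge0.
  exact: Expect_sqr_maxnorm.
exists (512 * (ch / cl) ^+ 3 / eps), k0 => k /hk0 Nk.
apply: markov => //; first exact: card_valid_neq0.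
rewrite (@eq_Expect _ _ _ _ _ (fun z : {ffun _ -> _} => opnorm (Vhat (Nq k) (Y k) (F k) z -
  EVhat (Nq k) (Y k) (F k)) ^+ 2)); last by move=> z; rewrite ger0_norm ?sqr_ge0.
exact: Expect_sqr_opnorm.
Qed.
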